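(* Let $p$ be a prime, $q=p^{n}$, and $F=\mathrm{GF}(q)=\{a_{0}=0,a_{1},\dots,a_{q-1}\}$. For $c\in F$ let $f_{c}:F\to F$, $f_{c}(x)=cx$, and let $M(f_{c})$ be the $q\times q$ matrix over $F$, with rows and columns indexed by the elements of $F$, whose $(a,b)$ entry is $f_{c}(b-a)$. Let $H_{q}$ be the $q^{2}\times q^{2}$ block matrix whose $(i,m)$ block ($0\le i,m\le q-1$) is $M(f_{a_{i}+a_{m}})$. Let $J$ be the $q^{2}\times q^{2}$ matrix all of whose entries equal $1\in F$. Let $H$ be the $q^{3}\times q^{3}$ block matrix $H=[K_{i,m}]_{0\le i,m\le q-1}$ with $(i,m)$ block $K_{i,m}=a_{i}a_{m}J+H_{q}$ (so the blocks in block-row $0$ and block-column $0$ are all $H_{q}$). Then $H$ is a $\mathrm{GH}(q,q^{2})$ over the additive group of $F$.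
   Context: For a finite additive abelian group $U$ of order $u$ and a positive integer $\lambda$, a generalized Hadamard matrix $\mathrm{GH}(u,\lambda)$ over $U$ is a square matrix $[d_{ij}]$ of order $u\lambda$ with entries in $U$ such that for any two distinct rows $i\neq \ell$, the multiset $\{d_{ij}-d_{\ell j}: 1\le j\le u\lambda\}$ contains each element of $U$ exactly $\lambda$ times. *)

(* Defs.v *)
From mathcomp Require Import all_boot all_order all_algebra.

Set Implicit Arguments.
Unset Strict Implicit.
Unset Printing Implicit Defensive.

Import GRing.Theory.
Local Open Scope ring_scope.

(* D is a GH(u, lambda) over U; the order N is a separate parameter, constrained
   to be u * lambda, because \mxblock matrices have order \sum_i n_i. *)
Definition is_GH (U : finZmodType) (u lambda N : nat) (D : 'M[U]_N) : Prop :=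
  [/\ #|U| = u, (0 < lambda)%N, N = (u * lambda)%N &
      forall i l : 'I_N, i != l ->
      forall x : U, #|[set j : 'I_N | D i j - D l j == x]| = lambda].

Definition fmul (F : finFieldType) (c : F) : F -> F := fun x => c * x.

(* Matrices indexed by F are indexed by 'I_q through the listing a of F. *)
Definition Mfun (F : finFieldType) (q : nat) (a : 'I_q -> F) (f : F -> F)
  : 'M[F]_q := \matrix_(r < q, s < q) f (a s - a r).

Definition Hq (F : finFieldType) (q : nat) (a : 'I_q -> F)
  : 'M[F]_(\sum_(i < q) q) :=
  \mxblock_(i < q, m < q) Mfun a (fmul (a i + a m)).

Definition Jmx (F : finFieldType) (q : nat) : 'M[F]_(\sum_(i < q) q) :=
  const_mx 1.

Definition Hbig (F : finFieldType) (q : nat) (a : 'I_q -> F)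
  : 'M[F]_(\sum_(i < q) \sum_(j < q) q) :=
  \mxblock_(i < q, m < q) ((a i * a m) *: Jmx F q + Hq a).

(* Main.v *)
(** Name the rows of [H] by triples (alpha, i, r) and its columns by triples
    (mu, m, s) in F^3; the corresponding entry is alpha mu + (i + m)(s - r).
    The difference of the rows (alpha, i, r) and (alpha', i', r') is therefore
      (alpha - alpha') mu + (r' - r) m + (i - i') s + constant,
    an affine function of the column.  For distinct rows its linear part is
    nonzero, so translations of F^3 permute its fibers transitively, and each
    of the q values is taken q^3 / q = q^2 times. *)

Require Import Defs.
From mathcomp Require Import all_boot all_order all_algebra.
From mathcomp Require Import ring.

Set Implicit Arguments.
Unset Strict Implicit.
Unset Printing Implicit Defensive.

Import GRing.Theory.
Local Open Scope ring_scope.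

(** The injection attached to the shift [z - y] carries the fiber over [y] into the fiber over [z].
    Hence all fibers have equal size, and they partition [T]. *)
Lemma card_fiber_of_translations (T : finType) (U : finZmodType) (f : T -> U) :
    (forall u, exists2 g : T -> T, injective g & forall t, f (g t) = f t + u) ->
  forall x, (#|U| * #|[set t | f t == x]|)%N = #|T|.
Proof.
move=> shift x.
have le_fib y z : (#|[set t | f t == y]| <= #|[set t | f t == z]|)%N.
  have [g g_inj fg] := shift (z - y).
  rewrite -(card_imset _ g_inj); apply/subset_leq_card/subsetP => v /imsetP[t].
  by rewrite !inE => /eqP ft ->; rewrite fg ft addrC subrK.
have -> : #|T| = (\sum_(y : U) #|[set t | f t == y]|)%N.
  rewrite -sum1_card (partition_big f predT) //=.
  by apply: eq_bigr => y _; rewrite sum1dep_card.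
rewrite -sum_nat_const; apply: eq_bigr => y _.
by apply/eqP; rewrite eqn_leq !le_fib.
Qed.

Lemma linear_form_surjective (F : fieldType) (c : F * F * F) (u : F) :
  c != (0, 0, 0) ->
  exists w : F * F * F, c.1.1 * w.1.1 + c.1.2 * w.1.2 + c.2 * w.2 = u.
Proof.
case: c => [[c1 c2] c3] /=.
have [-> | c1n0 _] := eqVneq c1 0; last first.
  by exists (u / c1, 0, 0) => /=; rewrite !mulr0 !addr0 mulrC divfK.
have [-> | c2n0 _] := eqVneq c2 0; last first.
  by exists (0, u / c2, 0) => /=; rewrite !mulr0 add0r addr0 mulrC divfK.
have [-> | c3n0 _] := eqVneq c3 0; first by rewrite eqxx.
by exists (0, 0, u / c3) => /=; rewrite !mulr0 !add0r mulrC divfK.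
Qed.

(** Translation by a vector on which the linear part takes the value [u] shifts the form by [u], so
    [#|F|] equal fibers share the [#|F| ^ 3] points. *)
Lemma card_affine_fiber (F : finFieldType) (c : F * F * F) (d x : F) :
    c != (0, 0, 0) ->
  #|[set v : F * F * F |
      c.1.1 * v.1.1 + c.1.2 * v.1.2 + c.2 * v.2 + d == x]| = (#|F| ^ 2)%N.
Proof.
move=> c_neq0.
have F_gt0 : (0 < #|F|)%N by apply/card_gt0P; exists 0.
apply/eqP; rewrite -(eqn_pmul2l F_gt0) card_fiber_of_translations; last first.
  move=> u; have [w <-] := linear_form_surjective u c_neq0.
  exists (fun v => (v.1.1 + w.1.1, v.1.2 + w.1.2, v.2 + w.2)).
    by move=> [[? ?] ?] [[? ?] ?] /= [/addIr -> /addIr -> /addIr ->].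
  by move=> v /=; ring.
by rewrite !card_prod -mulnA mulnA.
Qed.

(** Outer block, inner block, position: [tagnat.sig2 j] is itself an index into [Hq], so it is split
    a second time. *)
Definition index_triple (F : finFieldType) (q : nat) (a : 'I_q -> F)
    (j : 'I_(\sum_(i < q) \sum_(k < q) q)) : F * F * F :=
  (a (tagnat.sig1 j), a (tagnat.sig1 (tagnat.sig2 j)),
   a (tagnat.sig2 (tagnat.sig2 j))).

(** The type of [tagnat.sig2 j] depends on [tagnat.sig1 j]; constant block size lets both offsets be
    compared in ['I_n]. *)
Lemma tagnat_const_inj (m n : nat) (j k : 'I_(\sum_(i < m) n)) :
    tagnat.sig1 j = tagnat.sig1 k ->
    tagnat.sig2 j = tagnat.sig2 k :> 'I_n ->
  j = k.
Proof.
move=> e1 e2; apply: (can_inj tagnat.sigK); rewrite !tagnat.sigE12.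
by move: (tagnat.sig1 j) (tagnat.sig2 j) e1 e2 => ? ? -> ->.
Qed.

Lemma index_triple_inj (F : finFieldType) (q : nat) (a : 'I_q -> F) :
  injective a -> injective (index_triple a).
Proof.
move=> a_inj j k [/a_inj e1 /a_inj e2 /a_inj e3].
by apply: tagnat_const_inj e1 _; apply: tagnat_const_inj e2 e3.
Qed.

Lemma HbigE (F : finFieldType) (q : nat) (a : 'I_q -> F) i j :
    let r := index_triple a i in let c := index_triple a j in
  Hbig a i j = r.1.1 * c.1.1 + (r.1.2 + c.1.2) * (c.2 - r.2).
Proof. by rewrite /= !mxE mulr1. Qed.

Theorem theorem3p3 (p n q : nat) (F : finFieldType) (a : 'I_q -> F)
  (p_prime : prime p) (q_def : q = (p ^ n)%N) (card_F : #|F| = q)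
  (a_bij : bijective a)
  (a0 : forall i : 'I_q, nat_of_ord i = 0%N -> a i = 0%R) :
  is_GH (U := F) q (q ^ 2)%N (Hbig a).
Proof.
have tri_inj := index_triple_inj (bij_inj a_bij).
have order_H : (\sum_(i < q) \sum_(j < q) q = q * q ^ 2)%N.
  by rewrite !sum_nat_const !card_ord.
have q_gt0 : (0 < q)%N by rewrite -card_F; apply/card_gt0P; exists 0.
split=> //; first by rewrite expn_gt0 q_gt0.
move=> i l neq_il x.
pose r := index_triple a i; pose r' := index_triple a l.
(* The product of the two column coordinates [m] and [s] occurs in both rows and cancels, which
   leaves an affine form; [d] collects the terms free of column coordinates. *)
pose c := (r.1.1 - r'.1.1, r'.2 - r.2, r.1.2 - r'.1.2).
pose d := r'.1.2 * r'.2 - r.1.2 * r.2.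
have c_neq0 : c != (0, 0, 0).
  apply: contra neq_il => /eqP[/subr0_eq e1 /subr0_eq e2 /subr0_eq e3].
  by apply/eqP/tri_inj; congr (_, _, _).
have tri_bij : bijective (index_triple a).
  by apply: inj_card_bij => //; rewrite card_ord order_H !card_prod card_F -mulnA.
have := card_affine_fiber d x c_neq0; rewrite card_F => <-.
(* The count over [F * F * F] is pulled back to column indices along the bijection. *)
rewrite -(on_card_preimset (f := index_triple a)); last exact: onW_bij.
apply: eq_card => j; rewrite !inE !HbigE /d /r /r' /=.
by congr (_ == _); ring.
Qed.
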